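(* Let $t>0$ be a real number and let $M=(X,d)$ be a metric space. Then $M$ is totally bounded if and only if the gravitational metric space $M_t=(X,d_t)$ is totally bounded.
   Context: For a metric space $M=(X,d)$ and a real number $t>0$, the gravitational metric space $M_t=(X,d_t)$ is the set $X$ equipped with the metric $d_t(x,y)=\min\{2t,d(x,y)\}$ for all $x,y\in X$. A metric space $(X,d)$ is totally bounded if for every $\epsilon>0$ there is a finite set $S\subseteq X$ with $X=\bigcup_{s\in S}B_\epsilon(s)$, where $B_\epsilon(s)=\{x\in X: d(x,s)<\epsilon\}$. *)

(* Defs.v *)
From HB Require Import structures.
From mathcomp Require Import all_boot all_order all_algebra.
From mathcomp Require Import all_classical all_reals topology.

Set Implicit Arguments.
Unset Strict Implicit.
Unset Printing Implicit Defensive.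

Import Order.TTheory GRing.Theory Num.Theory.

Local Open Scope classical_set_scope.
Local Open Scope ring_scope.

(* An alias of the carrier of M, so that it can bear a second metric; the
   positivity of t is what makes the truncated distance separate points. *)
Definition gravitational (R : realType) (t : R) (t_gt0 : 0 < t)
  (M : metricType R) : Type := M.

Section gravitational_metric.
Context (R : realType) (t : R) (t_gt0 : 0 < t) (M : metricType R).

Let dt (x y : M) : R := Num.min (2 * t) (mdist x y).

Let two_t_gt0 : 0 < 2 * t.
Proof. by rewrite mulr_gt0. Qed.

Let dtxx x : dt x x = 0.
Proof. by rewrite /dt mdistxx; apply/min_idPr/ltW. Qed.

Let dt_positivity x y : dt x y = 0 -> x = y.
Proof.
rewrite /dt; case: leP => [_ t0|_]; last exact: mdist_positivity.
by move: two_t_gt0; rewrite t0 ltxx.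
Qed.

Let dt_sym x y : dt x y = dt y x.
Proof. by rewrite /dt metric_sym. Qed.

Let dt_triangle y x z : dt x z <= dt x y + dt y z.
Proof.
have t0 := ltW two_t_gt0; rewrite /dt.
case: (leP _ (mdist x y)) => [_|_].
  by rewrite ge_min lerDl le_min t0 mdist_ge0.
case: (leP _ (mdist y z)) => [_|_].
  by rewrite ge_min lerDr mdist_ge0.
by rewrite ge_min metric_triangle orbT.
Qed.

HB.instance Definition _ := Choice.on (gravitational t_gt0 M).
HB.instance Definition _ := @isMetric.Build R (gravitational t_gt0 M)
  dt dtxx dt_positivity dt_sym dt_triangle.

End gravitational_metric.

Lemma gravitational_mdistE (R : realType) (t : R) (t_gt0 : 0 < t)
    (M : metricType R) (x y : M) :
  mdist (x : gravitational t_gt0 M) (y : gravitational t_gt0 M) =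
  Num.min (2 * t) (mdist x y).
Proof. by []. Qed.

(* [ball s e] is [[set x | mdist s x < e]], by [ballEmdist]. *)
Definition totally_bounded (R : realType) (M : metricType R) : Prop :=
  forall e : R, 0 < e ->
    exists S : set M, finite_set S /\ [set: M] = \bigcup_(s in S) ball s e.

(* Main.v *)
Require Import Defs.
From mathcomp Require Import all_boot all_order all_algebra.
From mathcomp Require Import all_classical all_reals topology.

(** Truncating the distance at [2 * t] enlarges balls, but leaves those of
    radius at most [2 * t] unchanged ([gravitational_ballE]). Total boundedness
    only depends on small radii, since a cover by balls remains a cover when the
    balls are enlarged about the same centres. In other words, the identity is
    uniformly continuous from each metric to the other, and a uniformly
    continuous surjection preserves total boundedness
    ([totally_bounded_transfer]). *)

Import Order.TTheory GRing.Theory Num.Theory.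

Local Open Scope classical_set_scope.
Local Open Scope ring_scope.

(** The hypothesis on balls is uniform continuity of [f]: since [r] does not
    depend on the centre, the images of the centres of a finite cover of [M] by
    [r]-balls are centres of [e]-balls covering the image of [f]. For the
    truncated metric, [f] is the identity in one direction or the other. *)
Lemma totally_bounded_transfer (R : realType) (M N : metricType R)
    (f : M -> N) : (forall y, exists x, f x = y) ->
    (forall e : R, 0 < e -> exists2 r : R, 0 < r &
       forall s x : M, ball s r x -> ball (f s) e (f x)) ->
  totally_bounded M -> totally_bounded N.
Proof.
move=> f_surj f_ball tbM e e_gt0.
have [r r_gt0 ball_re] := f_ball e e_gt0.
have [S [finS coverS]] := tbM r r_gt0.
exists (f @` S); split; first exact: finite_image.
apply/esym; rewrite -subTset => y _.
have [x <-] := f_surj y.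
have : [set: M] x by [].
rewrite coverS => -[s Ss ball_sx].
by exists (f s); [exists s | exact: ball_re].
Qed.

Lemma ball_gravitational (R : realType) (t : R) (t_gt0 : 0 < t)
    (M : metricType R) (s x : M) (e : R) :
  ball s e x ->
  ball (s : gravitational t_gt0 M) e (x : gravitational t_gt0 M).
Proof.
by rewrite !ballEmdist /= gravitational_mdistE gt_min => ->; rewrite orbT.
Qed.

(** Below the truncation level, a minimum smaller than [e] can only be attained
    by the original distance. *)
Lemma gravitational_ballE (R : realType) (t : R) (t_gt0 : 0 < t)
    (M : metricType R) (s x : M) (e : R) : e <= 2 * t ->
  ball (s : gravitational t_gt0 M) e (x : gravitational t_gt0 M) <->
  ball s e x.
Proof.
move=> le_e2t; split; last exact: ball_gravitational.
by rewrite !ballEmdist /= gravitational_mdistE gt_min ltNge le_e2t.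
Qed.

Theorem theorem6 (R : realType) (t : R) (t_gt0 : 0 < t) (M : metricType R) :
  totally_bounded M <-> totally_bounded (gravitational t_gt0 M).
Proof.
split.
  apply: (@totally_bounded_transfer _ M (gravitational t_gt0 M) id).
    by move=> y; exists y.
  by move=> e e_gt0; exists e => // s x; exact: ball_gravitational.
apply: (@totally_bounded_transfer _ (gravitational t_gt0 M) M id).
  by move=> y; exists y.
move=> e e_gt0; exists (Num.min e (2 * t)).
  by rewrite lt_min e_gt0 mulr_gt0.
move=> s x /gravitational_ballE ball_sx.
apply: (@le_ball R M s (Num.min e (2 * t)) e _ x); first by rewrite ge_min lexx.
by apply: ball_sx; rewrite ge_min lexx orbT.
Qed.
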